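(* Let $d\in\mathbb{N}$, let $\mathbb{F}_q$ be a finite field with $q$ elements, let $\phi:\mathbb{F}_q\to\{0,1,\dots,q-1\}$ be a bijection with $\phi(0)=0$, and let $q_1(x),\dots,q_d(x)\in\mathbb{F}_q[x]$ be monic, non-constant, pairwise coprime polynomials of degrees $e_1,\dots,e_d\ge1$. Let $C^{(1)},\dots,C^{(d)}$ be generating matrices obtained from $q_1,\dots,q_d$ either all via the Niederreiter construction or all via the column-by-column construction (both described in the context). Then the digital sequence $(\bm{x}_n)_{n\ge0}$ in $[0,1)^d$ generated by $C^{(1)},\dots,C^{(d)}$ (a digital $(0,\bm{e},d)$-sequence with $\bm e=(e_1,\dots,e_d)$) does not have Poissonian pair correlations.
   Context: Digital method: given matrices $C^{(1)},\dots,C^{(d)}\in\mathbb{F}_q^{\mathbb{N}\times\mathbb{N}_0}$ (rows indexed by $i\ge1$, columns by $k\ge0$, each column having finitely many nonzero entries), for $n\in\mathbb{N}_0$ write $n=n_0+n_1q+n_2q^2+\cdots$ with $n_i\in\{0,\dots,q-1\}$, set $C^{(j)}\cdot(\phi^{-1}(n_0),\phi^{-1}(n_1),\dots)^\top=:(y^{(j)}_1,y^{(j)}_2,\dots)^\top$ and $x^{(j)}_n:=\sum_{i\ge1}\phi(y^{(j)}_i)q^{-i}$; then $\bm{x}_n=(x^{(1)}_n,\dots,x^{(d)}_n)$. Niederreiter construction: for row index $i\ge1$ of $C^{(j)}$ write uniquely $i=e_js-r$ with $s\in\mathbb{N}$, $r\in\{0,\dots,e_j-1\}$; expand $\frac{x^r}{q_j(x)^s}=\sum_{k\ge0}a^{(j)}(s,r,k)x^{-k-1}\in\mathbb{F}_q((x^{-1}))$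 and let the $i$-th row of $C^{(j)}$ be $(a^{(j)}(s,r,k))_{k\ge0}$. Column-by-column construction: for $k\in\mathbb{N}_0$ write $x^k=\sum_{s\ge0}b_s(x)q_j(x)^s$ with $b_s(x)\in\mathbb{F}_q[x]$, $\deg b_s<e_j$ (finitely many nonzero), and $b_s(x)=b_{s,0}+b_{s,1}x+\dots+b_{s,e_j-1}x^{e_j-1}$. The $k$-th column $(\sigma^{(j)}_{t,k})_{t\ge1}$ of $C^{(j)}$ is given by $(\sigma^{(j)}_{e_js+1,k},\dots,\sigma^{(j)}_{e_js+e_j,k})=(b_{s,0},\dots,b_{s,e_j-1})$ for all $s\ge0$. Poissonian pair correlations: with $\|y\|$ the distance to the nearest integer and $\|\bm{x}\|_\infty=\max_j\|x^{(j)}\|$, a sequence $(\bm{x}_n)_{n\ge0}$ in $[0,1)^d$ has Poissonian pair correlations if for every real $s\ge0$, $\frac1N\#\{0\le n\ne l\le N-1:\|\bm{x}_n-\bm{x}_l\|_\infty\le sN^{-1/d}\}\to(2s)^d$ as $N\to\infty$. *)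

(* Defs.v *)
From mathcomp Require Export all_boot all_order all_algebra.
From mathcomp Require Export all_classical all_reals all_analysis.

Set Implicit Arguments.
Unset Strict Implicit.
Unset Printing Implicit Defensive.

Export Order.TTheory GRing.Theory Num.Theory.
Export numFieldNormedType.Exports.

Local Open Scope classical_set_scope.
Local Open Scope ring_scope.

(* Infinite generating matrices over F are functions C : nat -> nat -> F; the
   rows are numbered from 1 (row 0 is never used), the columns from 0. *)

Section Digital.
Variables (R : realType) (F : finFieldType) (phi : F -> 'I_#|F|).

(* phi^-1 m; the default 0 is irrelevant when m < #|F| and phi is bijective. *)
Definition phi_inv (m : nat) : F :=
  odflt 0 [pick a : F | (phi a : nat) == m].

(* The k-th digit of n in base #|F|. *)
Definition digit (n k : nat) : nat := ((n %/ #|F| ^ k) %% #|F|)%N.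

(* The i-th entry of C . (phi^-1 n_0, phi^-1 n_1, ...)^T. The sum may be cut
   at k < n, because n < #|F| ^ n makes the digits n_k with k >= n vanish and
   phi^-1 0 = 0. *)
Definition digital_entry (C : nat -> nat -> F) (n i : nat) : F :=
  \sum_(0 <= k < n) C i k * phi_inv (digit n k).

Definition digital_coord (C : nat -> nat -> F) (n : nat) : R :=
  \big[+%R/0]_(1 <= i <oo)
     ((phi (digital_entry C n i) : nat)%:R / #|F|%:R ^+ i : R).

Definition digital_seq (d : nat) (C : 'I_d -> nat -> nat -> F) (n : nat) :
    'rV[R]_d :=
  \row_j digital_coord (C j) n.

End Digital.

Section Constructions.
Variable F : fieldType.

(* Elements of F((x^-1)) are represented by their coefficients: f m is the
   coefficient of x^m. *)
Definition laurent_of_poly (p : {poly F}) (m : int) : F :=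
  match m with Posz k => p`_k | Negz _ => 0 end.

(* \sum_(k >= 0) a k * x^(-k-1); recall that Negz k is the integer -k-1. *)
Definition laurent_frac (a : nat -> F) (m : int) : F :=
  match m with Posz _ => 0 | Negz k => a k end.

Definition laurent_mul (g : {poly F}) (f : int -> F) (m : int) : F :=
  \sum_(j < size g) g`_j * f (m - (j : nat)%:Z).

(* p / g = \sum_(k >= 0) a k * x^(-k-1) in the field F((x^-1)), for g != 0 *)
Definition laurent_expansion (p g : {poly F}) (a : nat -> F) : Prop :=
  forall m : int, laurent_mul g (laurent_frac a) m = laurent_of_poly p m.

(* Here (size g).-1 is the degree e of g. Each row index i >= 1 is e * s - r
   for exactly one s >= 1 and r < e, so all rows of C are determined. *)
Definition niederreiter_matrix (g : {poly F}) (C : nat -> nat -> F) : Prop :=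
  forall s r : nat, (0 < s)%N -> (r < (size g).-1)%N ->
    laurent_expansion 'X^r (g ^+ s) (C ((size g).-1 * s - r)%N).

(* The sequence b lists b_0, ..., b_(size b - 1); the later b_s are zero, in
   agreement with the default value of nth. The expansion of 'X^k is unique. *)
Definition column_matrix (g : {poly F}) (C : nat -> nat -> F) : Prop :=
  forall k : nat, exists b : seq {poly F},
    [/\ forall s : nat, (size (b`_s)%R <= (size g).-1)%N,
        'X^k = \sum_(s < size b) b`_s * g ^+ s
      & forall s l : nat, (l < (size g).-1)%N ->
          C ((size g).-1 * s + l.+1)%N k = (b`_s)`_l].

End Constructions.

Section PairCorrelations.
Variable R : realType.

(* The distance from y to the nearest integer. *)
Definition dist_int (y : R) : R :=
  inf [set `|y - m%:~R| | m in [set: int]].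

Definition dist_int_max (d : nat) (y : 'rV[R]_d) : R :=
  \big[Num.max/0]_(j < d) dist_int (y 0 j).

(* The number of ordered pairs n != l below N whose terms are at distance at
   most t. *)
Definition close_pairs (d : nat) (x : nat -> 'rV[R]_d) (N : nat) (t : R) : nat :=
  #|[set p : 'I_N * 'I_N |
      (p.1 != p.2) && (dist_int_max (x p.1 - x p.2) <= t)]%SET|.

Definition poissonian_pair_correlations (d : nat) (x : nat -> 'rV[R]_d) : Prop :=
  forall s : R, 0 <= s ->
    (fun N : nat =>
       (close_pairs x N (s * N%:R `^ (- d%:R^-1)))%:R / N%:R : R)
      @ \oo --> (2 * s) ^+ d.

End PairCorrelations.

(* Main.v *)
(** Write L_i^(j)(p) for the i-th entry of C^(j) p, with p in F_q[x] identified
    with its coefficient vector. Both constructions satisfy L_i^(j)(q_j^s u) = 0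
    for i <= e_j s and L_i^(j)(q_j^s) = 1 exactly when i = e_j s + 1 (and 0 for
    the other i). By Frobenius one can choose exponents s_j with all e_j s_j equal
    to the same m and prod_{i <> j} q_i^(s_i) = 1 modulo q_j^P, with P an
    arbitrarily large power of the characteristic; then Q = prod_i q_i^(s_i) has
    degree d m. For N = q^(d m + 1), pair each n < N with the l < N whose
    polynomial is that of n minus Q: in every coordinate the first m + P digits of
    x_n and x_l agree except for digit m + 1. Hence the distance of x_n and x_l is
    D q^(-m-1) up to q^(-m-P) for some D in {1, ..., q-1}, and after rescaling by
    N^(1/d) these N pairs concentrate at q - 1 points independent of m. The
    continuous limit (2 s)^d does not allow this. *)

Require Import Defs.
From mathcomp Require Import finfield zify ring lra.

Set Implicit Arguments.
Unset Strict Implicit.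
Unset Printing Implicit Defensive.

Local Open Scope ring_scope.

(** * Action of polynomials on Laurent coefficient sequences *)

Section LaurentMul.
Variable F : fieldType.
Implicit Types (p g : {poly F}) (f : int -> F) (m : int).

Lemma laurent_mul_widen p f m n : (size p <= n)%N ->
  laurent_mul p f m = \sum_(j < n) p`_j * f (m - (j : nat)%:Z).
Proof.
move=> le_pn; rewrite /laurent_mul
  (big_ord_widen n (fun j : nat => p`_j * f (m - j%:Z))) //.
rewrite [RHS](bigID (fun i : 'I_n => i < size p)%N) /= [X in _ + X]big1 ?addr0 //.
by move=> i; rewrite -leqNgt => /(nth_default 0) ->; rewrite mul0r.
Qed.

Lemma laurent_mulD p1 p2 f m :
  laurent_mul (p1 + p2) f m = laurent_mul p1 f m + laurent_mul p2 f m.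
Proof.
pose n := maxn (size p1) (size p2).
rewrite !(@laurent_mul_widen _ _ _ n) ?leq_maxl ?leq_maxr ?size_polyD //.
by rewrite -big_split; apply: eq_bigr => i _; rewrite coefD mulrDl.
Qed.

Lemma laurent_mulC c f m : laurent_mul c%:P f m = c * f m.
Proof.
rewrite (@laurent_mul_widen _ _ _ 1) ?size_polyC_leq1 //.
by rewrite big_ord1 coefC subr0.
Qed.

Lemma laurent_mulMX p f m :
  laurent_mul (p * 'X) f m = laurent_mul p f (m - 1).
Proof.
have le_pX : (size (p * 'X)%R <= (size p).+1)%N.
  by apply: (leq_trans (size_polyMleq _ _)); rewrite size_polyX addn2.
rewrite (@laurent_mul_widen _ _ _ (size p).+1 le_pX) big_ord_recl coefMX mul0r add0r.
apply: eq_bigr => i _; rewrite coefMX /=; congr (_ * f _).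
by rewrite /bump /= add1n -addn1 PoszD opprD addrA addrAC.
Qed.

Lemma eq_laurent_mul p f f' m : f =1 f' -> laurent_mul p f m = laurent_mul p f' m.
Proof. by move=> eq_f; apply: eq_bigr => i _; rewrite eq_f. Qed.

(** Induction on [p] in Horner form reduces this to constants and multiplication by x. It later
    allows powers of g to be cancelled against a denominator. *)
Lemma laurent_mulA p g f m :
  laurent_mul (p * g) f m = laurent_mul p (laurent_mul g f) m.
Proof.
elim/poly_ind: p m => [|p c IHp] m;
  first by rewrite mul0r /laurent_mul size_poly0 !big_ord0.
rewrite mulrDl !laurent_mulD laurent_mulMX laurent_mulC mulrAC laurent_mulMX IHp.
congr (_ + _); rewrite /laurent_mul mulr_sumr.
case: (eqVneq c 0) => [->|c0].
  rewrite mul0r size_poly0 big_ord0 big1 // => i _.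
  by rewrite mul0r.
by rewrite size_Cmul //; apply: eq_bigr => i _; rewrite coefCM mulrA.
Qed.

End LaurentMul.

(** * Linear forms given by the rows, for both constructions *)

Section RowForms.
Variable F : fieldType.
Implicit Types (p g h u : {poly F}) (f : int -> F) (C : nat -> nat -> F).

Definition row_form C i p : F := \sum_(k < size p) C i k * p`_k.

Lemma row_form_widen C i p n : (size p <= n)%N ->
  row_form C i p = \sum_(k < n) C i k * p`_k.
Proof.
move=> le_pn; rewrite /row_form (big_ord_widen n (fun k => C i k * p`_k)) //.
rewrite [RHS](bigID (fun i : 'I_n => i < size p)%N) /= [X in _ + X]big1 ?addr0 //.
by move=> k; rewrite -leqNgt => /(nth_default 0) ->; rewrite mulr0.
Qed.

Lemma row_formD C i p1 p2 :
  row_form C i (p1 + p2) = row_form C i p1 + row_form C i p2.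
Proof.
pose n := maxn (size p1) (size p2).
rewrite !(@row_form_widen _ _ _ n) ?leq_maxl ?leq_maxr ?size_polyD //.
by rewrite -big_split; apply: eq_bigr => k _; rewrite coefD mulrDr.
Qed.

Lemma row_formN C i p : row_form C i (- p) = - row_form C i p.
Proof.
by rewrite /row_form size_polyN -sumrN; apply: eq_bigr => k _; rewrite coefN mulrN.
Qed.

(** In the product of p with the series sum_k C_(i,k) x^(-k-1), the coefficient p_k meets C_(i,k)
    exactly at exponent -1. *)
Lemma row_form_laurent C i p :
  row_form C i p = laurent_mul p (laurent_frac (C i)) (- 1).
Proof.
apply: eq_bigr => k _; rewrite mulrC; congr (_ * _).
by have -> : - 1 - (k : nat)%:Z = Negz k by rewrite NegzE; lia.
Qed.

(** The common ground of both constructions: the final argument uses the matrices only through these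
    two rules. *)
Definition adic_rows g C : Prop :=
  (forall s u i, (0 < i <= (size g).-1 * s)%N -> row_form C i (u * g ^+ s) = 0) /\
  (forall s i, (0 < i)%N ->
     row_form C i (g ^+ s) = (i == ((size g).-1 * s).+1)%:R).

Lemma row_decomp e i : (0 < e)%N -> (0 < i)%N ->
  exists s r, [/\ (0 < s)%N, (r < e)%N & i = (e * s - r)%N].
Proof.
move=> e0 i0; exists (i.-1 %/ e).+1, (e.-1 - i.-1 %% e)%N.
have := ltn_pmod i.-1 e0; have := divn_eq i.-1 e.
rewrite mulnS [(e * _)%N]mulnC; move: (_ * e)%N (_ %% e)%N => a b def_i lt_b.
by split=> [||]; rewrite ?ltn0Sn //; lia.
Qed.

Lemma size_monic_exp g s : g \is monic -> size (g ^+ s) = ((size g).-1 * s).+1.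
Proof.
by move=> gm; rewrite -size_exp prednK // size_poly_gt0 expf_neq0 // monic_neq0.
Qed.

Lemma laurent_mul_poly_neg p u (n : nat) :
  laurent_mul p (laurent_of_poly u) (Negz n) = 0.
Proof.
rewrite /laurent_mul big1 // => j _.
have -> : Negz n - (j : nat)%:Z = Negz (n + j) by rewrite !NegzE; lia.
exact: mulr0.
Qed.

Lemma laurent_mul_frac_ge p a (m : nat) : (size p <= m.+1)%N ->
  laurent_mul p (laurent_frac a) m = 0.
Proof.
move=> le_pm; rewrite /laurent_mul big1 // => j _.
have -> : (m : int) - (j : nat)%:Z = (m - j)%N by have := ltn_ord j; lia.
by rewrite mulr0.
Qed.

(* f has no polynomial part, so h f has top term f(-1) x^n. *)
Lemma laurent_mul_top h f n : h \is monic -> (forall m : nat, f m = 0) ->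
  size h = n.+2 -> laurent_mul h f n = f (- 1).
Proof.
move=> hm f0 szh; rewrite /laurent_mul szh big_ord_recr /= big1 => [|j _].
  have /eqP := hm; rewrite lead_coefE szh /= => ->.
  by rewrite add0r mul1r; congr f; lia.
have -> : (n : int) - (j : nat)%:Z = (n - j)%N by have := ltn_ord j; lia.
by rewrite f0 mulr0.
Qed.

(** A highest surviving term of [f] at x^k, k >= 0, would reappear in [h f] at x^(deg h + k) with
    the same coefficient, as [h] is monic. The induction on [M] removes such terms from the top. *)
Lemma laurent_mul_vanish h f (M : nat) : h \is monic ->
  (forall m : nat, (M <= m)%N -> f m = 0) ->
  (forall m : nat, laurent_mul h f ((size h).-1 + m)%N = 0) ->
  forall m : nat, f m = 0.
Proof.
move=> hm; elim: M => [|M IH] fM hf m; first exact: fM.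
apply: IH m => // m le_Mm; case: (ltnP M m) => [|le_mM]; first exact: fM.
have {le_Mm le_mM} -> : m = M by apply/eqP; rewrite eqn_leq le_mM.
have h0 : (0 < size h)%N by rewrite size_poly_gt0 monic_neq0.
have := hf M; rewrite (@laurent_mul_widen _ _ _ _ (size h).-1.+1 (leqSpred _))
  big_ord_recr /= big1 => [|j _].
  have /eqP := hm; rewrite lead_coefE => ->.
  by rewrite add0r mul1r => <-; congr f; lia.
have lt_j : (j < (size h).-1)%N := ltn_ord j.
rewrite subzn ?(leq_trans (ltnW lt_j)) ?leq_addr //.
by rewrite fM ?mulr0 // ltn_subRL ltn_add2r.
Qed.

Lemma niederreiter_adic_rows g C : g \is monic -> (1 < size g)%N ->
  niederreiter_matrix g C -> adic_rows g C.
Proof.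
move=> gm g1 hC; have e0 : (0 < (size g).-1)%N by lia.
split=> [s u i /andP[i0 le_i]|s i i0];
  have [s' [r [s'0 lt_r def_i]]] := row_decomp e0 i0;
  have hrow := hC _ _ s'0 lt_r; rewrite -def_i in hrow;
  rewrite row_form_laurent.
  (* Since i = e s' - r <= e s with r < e, the denominator g^s' cancels and the product is a
     polynomial, without a term x^(-1). *)
  have le_s : (s' <= s)%N by rewrite -ltnS -(ltn_pmul2l e0) mulnS; lia.
  rewrite -(subnK le_s) exprD mulrA laurent_mulA (eq_laurent_mul _ _ hrow).
  exact: (@laurent_mul_poly_neg _ _ 0).
case: (leqP s' s) => [le_s|lt_s].
  rewrite -(subnK le_s) exprD laurent_mulA (eq_laurent_mul _ _ hrow) subnK //.
  rewrite (@laurent_mul_poly_neg _ _ 0) //.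
  case: eqP => // def_i'; have := leq_mul (leqnn (size g).-1) le_s; lia.
(* For s < s', [f] is x^r / h with deg h >= e > r. So it has no polynomial part, and f(-1) is the
   coefficient of x^(deg h - 1) in h f = x^r. This is 1 exactly if r = e (s' - s) - 1, that is, i =
   e s + 1. *)
set f := laurent_mul (g ^+ s) _; pose h := g ^+ (s' - s).
have hm : h \is monic by rewrite monic_exp.
have szh : size h = ((size g).-1 * (s' - s)).+1 by rewrite size_monic_exp.
have hf m : laurent_mul h f m = laurent_of_poly 'X^r m.
  by rewrite -laurent_mulA -exprD subnK ?hrow // ltnW.
have le_e : ((size g).-1 <= (size g).-1 * (s' - s))%N by rewrite leq_pmulr ?subn_gt0.
have f0 (m : nat) : f m = 0.
  apply: (@laurent_mul_vanish h f ((size g).-1 * s)) m => // [m le_m|m].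
    by apply: laurent_mul_frac_ge; rewrite size_monic_exp.
  by rewrite hf /= coefXn szh /= gtn_eqF // (leq_trans lt_r) //
    (leq_trans le_e) ?leq_addr.
have def_E : ((size g).-1 * (s' - s) + (size g).-1 * s = (size g).-1 * s')%N.
  by rewrite -mulnDr subnK // ltnW.
rewrite -(@laurent_mul_top h f ((size h).-2)) // ?hf /= ?coefXn szh /=;
  move: def_E le_e def_i lt_r e0; move: (_ * (s' - s))%N (_ * s)%N (_ * s')%N;
  move: (size g).-1 => e E1 E2 E3 def_E le_e def_i lt_r e0; last by lia.
by congr (_%:R); lia.
Qed.

(** The coefficient b_s of the g-adic expansion of [p], in a closed form that is linear in [p]. *)
Definition adic_digit g s p : {poly F} := (p %/ g ^+ s) %% g.

Lemma adic_digit_sum (I : Type) (r : seq I) (P : pred I) (G : I -> {poly F}) g s :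
  adic_digit g s (\sum_(i <- r | P i) G i) = \sum_(i <- r | P i) adic_digit g s (G i).
Proof.
rewrite /adic_digit (big_morph (fun p => p %/ g ^+ s) (divpD _) (div0p _)).
by rewrite (big_morph (fun p => p %% g) (modpD _) (mod0p _)).
Qed.

Lemma adic_digitM g s t u : g \is monic -> (size u < size g)%N ->
  adic_digit g s (u * g ^+ t) = if s == t then u else 0.
Proof.
move=> gm ltug; have g0 : g != 0 by rewrite monic_neq0.
have gs0 : g ^+ s != 0 by rewrite expf_neq0.
rewrite /adic_digit; case: (ltngtP s t) => [lt_st|lt_ts|<-].
- rewrite -(subnK (ltnW lt_st)) exprD mulrA mulpK //.
  by rewrite -[(t - s)%N]prednK ?subn_gt0 // exprSr mulrA modp_mull.
- rewrite divp_small ?mod0p // size_monic_exp //.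
  apply: (leq_ltn_trans (size_polyMleq _ _)); rewrite size_monic_exp //.
  rewrite addnS /= ltnS (leq_trans _ (leq_mul (leqnn (size g).-1) lt_ts)) //.
  by rewrite mulnS leq_add2r -ltnS prednK // (leq_ltn_trans _ ltug).
- by rewrite mulpK // modp_small.
Qed.

(** Both sides are linear in [p], so monomials suffice, and there the columns list the coefficients
    of the b_s. Writing i - 1 = e s + l turns the row number into position l of digit s. *)
Lemma column_digit g C i p : g \is monic -> (1 < size g)%N ->
  column_matrix g C -> (0 < i)%N ->
  row_form C i p =
    (adic_digit g (i.-1 %/ (size g).-1) p)`_(i.-1 %% (size g).-1).
Proof.
move=> gm g1 hC i0; rewrite -{2}[p]coefK poly_def adic_digit_sum coef_sum.
apply: eq_bigr => k _; rewrite /adic_digit divpZl modpZl coefZ mulrC; congr (_ * _).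
rewrite -/(adic_digit g (i.-1 %/ (size g).-1) _).
have [b [szb -> hb]] := hC k; set s := (i.-1 %/ _)%N; set l := (i.-1 %% _)%N.
have ltb t : (size (b`_t)%R < size g)%N by have := szb t; lia.
have -> : i = ((size g).-1 * s + l.+1)%N.
  by rewrite addnS mulnC -divn_eq prednK.
rewrite hb ?ltn_mod; last by lia.
rewrite adic_digit_sum; congr (_`_ _).
under eq_bigr => t _ do rewrite adic_digitM //.
case: (ltnP s (size b)) => [lt_s|le_s].
  rewrite (bigD1 (Ordinal lt_s)) //= eqxx big1 ?addr0 // => t.
  by rewrite -val_eqE /= eq_sym => /negPf ->.
rewrite nth_default // big1 // => t _; case: eqP => // def_s.
by have := ltn_ord t; rewrite -def_s ltnNge le_s.
Qed.

(** Multiples of g^s have no g-adic digits below s, and the only nonzero digit of g^s is 1, whose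
    constant coefficient sits in row e s + 1. *)
Lemma column_adic_rows g C : g \is monic -> (1 < size g)%N ->
  column_matrix g C -> adic_rows g C.
Proof.
move=> gm g1 hC; have e0 : (0 < (size g).-1)%N by lia.
have g0 : g != 0 by rewrite monic_neq0.
split=> [s u i /andP[i0 le_i]|s i i0]; rewrite (column_digit _ gm g1 hC i0).
  have lt_s : (i.-1 %/ (size g).-1 < s)%N by rewrite ltn_divLR // mulnC; lia.
  rewrite /adic_digit -(subnK (ltnW lt_s)) exprD mulrA mulpK ?expf_neq0 //.
  by rewrite -[(s - _)%N]prednK ?subn_gt0 // exprSr mulrA modp_mull coef0.
rewrite -[g ^+ s]mul1r adic_digitM ?size_poly1 //.
have def_i := divn_eq i.-1 (size g).-1; have lt_r := ltn_pmod i.-1 e0.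
rewrite [(i.-1 %/ _ * _)%N]mulnC in def_i.
case: eqP => [<-|neq_s]; rewrite ?coef1 ?coef0; first by congr (_%:R); lia.
case: eqP => // def_i'; case: neq_s.
by rewrite def_i' /= mulKn.
Qed.

End RowForms.

(** * Exponents that make products of the g_i congruent to 1 *)

Section Congruences.
Variable F : finFieldType.
Implicit Types a b g x y : {poly F}.

Lemma dvdp_expr_sub1 g x k : g %| x - 1 -> g %| x ^+ k - 1.
Proof. by move=> ?; rewrite subrX1 dvdp_mulr. Qed.

Lemma dvdp_mul_sub1 g x y : g %| x - 1 -> g %| y - 1 -> g %| x * y - 1.
Proof.
move=> gx gy; have -> : x * y - 1 = x * (y - 1) + (x - 1) by ring.
by rewrite dvdp_add // dvdp_mull.
Qed.

(** Pigeonhole: residues modulo [b] are finite in number, so two powers of [a] agree, and the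
    smaller one cancels by coprimality. *)
Lemma coprimep_order a b : b != 0 -> coprimep b a ->
  exists2 A, (0 < A)%N & b %| a ^+ A - 1.
Proof.
move=> b0 cop; pose f (i : 'I_(#|'rV[F]_(size b)|.+1)) : 'rV[F]_(size b) :=
  poly_rV (a ^+ i %% b).
have /injectivePn[i [j]] : ~~ injectiveb f.
  by apply/negP => /injectiveP/leq_card; rewrite card_ord ltnn.
wlog lt_ij : i j / (i < j)%N => [wlog_ij neq_ij|_].
  case: (ltngtP i j) => [lt_ij|lt_ji|/val_inj eq_ij]; first exact: wlog_ij.
    by move/esym; apply: wlog_ij => //; rewrite eq_sym.
  by rewrite eq_ij eqxx in neq_ij.
move/(congr1 rVpoly); rewrite !poly_rV_K; try by rewrite ltnW // ltn_modp.
move=> eq_mod; exists (j - i)%N; first by rewrite subn_gt0.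
rewrite -(@Gauss_dvdpr _ _ (a ^+ i)) ?coprimep_expr //.
rewrite mulrBr mulr1 -exprD subnKC ?(ltnW lt_ij) //.
by rewrite /dvdp modpD modpN eq_mod subrr.
Qed.

Lemma pairwise_coprimep_order d (g : 'I_d -> {poly F}) :
  (forall i, g i != 0) -> (forall i j, i != j -> coprimep (g i) (g j)) ->
  exists2 A, (0 < A)%N & forall i j, i != j -> g j %| g i ^+ A - 1.
Proof.
move=> g0 cop.
have /choice[A hA] (ij : 'I_d * 'I_d) :
    exists A, (0 < A)%N /\ (ij.1 != ij.2 -> g ij.2 %| g ij.1 ^+ A - 1).
  case: (eqVneq ij.1 ij.2) => [_|neq_ij]; first by exists 1%N.
  rewrite eq_sym in neq_ij; have [A] := coprimep_order (g0 ij.2) (cop _ _ neq_ij).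
  by exists A.
exists (\prod_ij A ij)%N => [|i j neq_ij].
  by rewrite prodn_gt0 // => ij; case: (hA ij).
by rewrite (bigD1 (i, j)) //= exprM dvdp_expr_sub1 //; have [_ /(_ neq_ij)] := hA (i, j).
Qed.

(** With a common order A, E = prod_i e_i and s_i = A p^w E / e_i, all e_i s_i equal A E p^w, and Q
    = prod_i g_i^(s_i) is g_j^(s_j) times a factor that is 1 modulo g_j^(p^w). The [A] of the
    statement is A E; the free [w] lets m and the precision p^w grow together. *)
Lemma common_near_power d (g : 'I_d -> {poly F}) :
  (forall i, g i \is monic) -> (forall i, 1 < size (g i))%N ->
  (forall i j, i != j -> coprimep (g i) (g j)) ->
  exists A p, [/\ (0 < A)%N, (1 < p)%N & forall w, exists Q : {poly F},
    size Q = (d * (A * p ^ w)).+1 /\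
    forall j, exists s u, ((size (g j)).-1 * s = A * p ^ w)%N /\
      Q = g j ^+ s + u * g j ^+ (s + p ^ w)].
Proof.
move=> gm g1 cop; have g0 i : g i != 0 by rewrite monic_neq0.
have e0 i : (0 < (size (g i)).-1)%N by rewrite -ltnS prednK // ltnW.
have [A A0 hA] := pairwise_coprimep_order g0 cop.
have [p p_pr pF] := finPcharP F.
pose E := (\prod_i (size (g i)).-1)%N.
have E0 : (0 < E)%N by rewrite prodn_gt0.
have dvE i : ((size (g i)).-1 %| E)%N by rewrite /E (bigD1 i) //= dvdn_mulr.
exists (A * E)%N, p; split=> [||w]; [by rewrite muln_gt0 A0|exact: prime_gt1|].
pose s i := (A * p ^ w * (E %/ (size (g i)).-1))%N.
have es i : ((size (g i)).-1 * s i = A * E * p ^ w)%N.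
  rewrite /s mulnCA [((size (g i)).-1 * _)%N]mulnC divnK // mulnAC //.
exists (\prod_i g i ^+ s i); split.
  have hsz i : true -> size (g i ^+ s i) = (A * E * p ^ w).+1.
    by rewrite size_monic_exp // es.
  rewrite size_prod => [|i _]; last by rewrite expf_neq0.
  rewrite (eq_bigr _ hsz) sum_nat_const card_ord mulnS -addnS addnC addnK //.
move=> j; exists (s j).
have : g j ^+ (p ^ w) %| \prod_(i | i != j) g i ^+ s i - 1.
  apply: (big_ind (fun x => g j ^+ (p ^ w) %| x - 1)) => [|x y|i neq_ij].
  - by rewrite subrr dvdp0.
  - exact: dvdp_mul_sub1.
  (* Frobenius: x^(p^w) - 1 = (x - 1)^(p^w) for x = g_i^A, which lifts divisibility by g_j to
     divisibility by g_j^(p^w). *)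
  have pP : [pchar {poly F}].-nat (p ^ w)%N.
    rewrite pnatX; apply/orP; left; rewrite pnatE // pchar_poly //.
  rewrite /s !exprM dvdp_expr_sub1 // -[g i ^+ A](subrK 1).
  by rewrite exprDn_pchar // expr1n addrK dvdp_exp2r // hA.
move=> /dvdpP[u def_u]; exists u; split=> //.
rewrite (bigD1 j) //= -[\prod_(i | _) _](subrK 1) def_u exprD; ring.
Qed.

End Congruences.

(** * Integers as polynomials through their digits *)

Section Digits.
Variables (F : finFieldType) (phi : F -> 'I_#|F|).
Hypotheses (phi_bij : bijective phi) (phi0 : (phi 0 : nat) = 0%N).

Lemma phi_invK a : phi_inv phi (phi a) = a.
Proof.
rewrite /phi_inv; case: pickP => [b /eqP/val_inj|/(_ a)]; last by rewrite eqxx.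
exact: (bij_inj phi_bij).
Qed.

Lemma phi_inv0 : phi_inv phi 0 = 0.
Proof. by rewrite -phi0 phi_invK. Qed.

Definition digits_poly n : {poly F} := \poly_(k < n) phi_inv phi (digit F n k).

Lemma digital_entryE C n i : digital_entry phi C n i = row_form C i (digits_poly n).
Proof.
rewrite (row_form_widen _ _ (size_poly _ _)) /digital_entry big_mkord.
by apply: eq_bigr => k _; rewrite coef_poly ltn_ord.
Qed.

Lemma digit_ge n k : (n < #|F| ^ k)%N -> digit F n k = 0%N.
Proof. by move=> lt_n; rewrite /digit divn_small // mod0n. Qed.

Lemma coef_digits_poly n k : (digits_poly n)`_k = phi_inv phi (digit F n k).
Proof.
rewrite coef_poly; case: ltnP => // le_nk; rewrite digit_ge ?phi_inv0 //.
exact: leq_ltn_trans le_nk (ltn_expl _ (card_finNzRing_gt1 F)).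
Qed.

Lemma size_digits_poly n M : (n < #|F| ^ M)%N -> (size (digits_poly n) <= M)%N.
Proof.
move=> lt_n; apply/leq_sizeP => k le_Mk; rewrite coef_digits_poly digit_ge ?phi_inv0 //.
by rewrite (leq_trans lt_n) // leq_exp2l // card_finNzRing_gt1.
Qed.

Lemma digits_exist M (c : nat -> F) : (forall k, (M <= k)%N -> c k = 0) ->
  exists2 l, (l < #|F| ^ M)%N & forall k, digit F l k = phi (c k).
Proof.
have q0 : (0 < #|F|)%N by rewrite ltnW ?card_finNzRing_gt1.
elim: M c => [|M IH] c hc.
  by exists 0%N => // k; rewrite digit_ge ?expn_gt0 ?q0 // hc.
have [l lt_l hl] := IH (fun k => c k.+1) (fun k => hc k.+1).
exists (l * #|F| + phi (c 0%N))%N => [|[|k]].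
- rewrite expnS mulnC [X in (_ < X)%N]mulnC
    (@leq_trans (l.+1 * #|F|)) ?leq_mul2r ?lt_l ?orbT //.
  by rewrite mulSn addnC [(l * _)%N]mulnC ltn_add2r.
- by rewrite /digit expn0 divn1 modnMDl modn_small.
- by rewrite -hl /digit expnS divnMA divnMDl // [(phi _ %/ _)%N]divn_small // addn0.
Qed.

(** Later supplies the partner l < N whose polynomial is that of n minus Q. *)
Lemma digits_poly_onto M (P : {poly F}) : (size P <= M)%N ->
  exists2 l, (l < #|F| ^ M)%N & digits_poly l = P.
Proof.
move=> leP; have [l lt_l hl] :
    exists2 l, (l < #|F| ^ M)%N & forall k, digit F l k = phi P`_k.
  by apply: digits_exist => k le_Mk; rewrite nth_default // (leq_trans leP).
by exists l => //; apply/polyP => k; rewrite coef_digits_poly hl phi_invK.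
Qed.

End Digits.

(** * Real numbers given by base-q expansions *)

Section Expansions.
Local Open Scope classical_set_scope.
Variables (R : realType) (q : nat).
Hypothesis q_gt1 : (1 < q)%N.

Let q0 : 0 < q%:R :> R. Proof. by rewrite ltr0n ltnW. Qed.

Lemma sum_digits_le (y : nat -> R) a b : (forall i, `|y i| <= (q.-1)%:R) ->
  \sum_(a.+1 <= i < b) `|y i / q%:R ^+ i| <= q%:R ^- a.
Proof.
move=> hy; case: (leqP b a) => [le_ba|lt_ab].
  by rewrite big_geq 1?leqW // invr_ge0 exprn_ge0 // ltW.
(* The telescoped bound carries the induction: (q - 1) q^-i = q^-(i-1) - q^-i, and the last index is
   b - 1. *)
suff: \sum_(a.+1 <= i < b) `|y i / q%:R ^+ i| <= q%:R ^- a - q%:R ^- b.-1.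
  by move=> /le_trans; apply; rewrite gerBl invr_ge0 exprn_ge0 // ltW.
elim: b lt_ab => // b IH; rewrite ltnS leq_eqVlt => /predU1P[<-|lt_ab].
  by rewrite big_geq // subrr.
rewrite big_nat_recr //= (le_trans (lerD (IH lt_ab) (lexx _))) //.
have qb0 : 0 < q%:R ^- b :> R by rewrite invr_gt0 exprn_gt0.
rewrite normrM (gtr0_norm qb0).
have -> : q%:R ^- b.-1 = q%:R * q%:R ^- b :> R.
  by rewrite -[in RHS](prednK (leq_ltn_trans (leq0n a) lt_ab))
    exprS invfM mulrA mulfV ?mul1r // gt_eqF.
have qE : q%:R = (q.-1)%:R + 1 :> R by rewrite natr1 prednK // ltnW.
have hq : q%:R / q%:R ^+ b = (q.-1)%:R / q%:R ^+ b + q%:R ^- b :> R.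
  by rewrite {1}qE mulrDl mul1r.
have := ler_wpM2r (ltW qb0) (hy b); rewrite hq; lra.
Qed.

Lemma is_cvg_expansion (y : nat -> nat) : (forall i, y i < q)%N ->
  cvgn (fun n => \sum_(1 <= i < n) ((y i)%:R / q%:R ^+ i : R)).
Proof.
move=> hy; have y0 i : 0 <= (y i)%:R / q%:R ^+ i :> R.
  by rewrite divr_ge0 // exprn_ge0 // ltW.
apply: nondecreasing_is_cvgn.
  apply/nondecreasing_seqP => n; case: n => [|n]; first by rewrite !big_geq.
  by rewrite [leRHS]big_nat_recr //= lerDl.
exists 1 => _ [n _ <-].
rewrite -[X in _ <= X]invr1 -[X in _ <= X^-1](expr0 q%:R).
apply: le_trans (@sum_digits_le (fun i => (y i)%:R) 0 n _) => [|i].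
  by apply: ler_sum => i _; exact: ler_norm.
by rewrite ger0_norm // ler_nat -ltnS prednK // ltnW.
Qed.

(** Up to T only the digits at k fail to cancel, which gives the subtracted main term. The rest is a
    tail with digit differences at most q - 1 in absolute value; the bound on partial sums passes to
    the limit. *)
Lemma expansion_diff (y z : nat -> nat) k T :
  (forall i, y i < q)%N -> (forall i, z i < q)%N -> (0 < k <= T)%N ->
  (forall i, (0 < i <= T)%N -> i != k -> y i = z i) ->
  `|\big[+%R/0]_(1 <= i <oo) ((y i)%:R / q%:R ^+ i : R)
    - \big[+%R/0]_(1 <= i <oo) ((z i)%:R / q%:R ^+ i : R)
    - ((y k)%:R - (z k)%:R) / q%:R ^+ k| <= q%:R ^- T.
Proof.
move=> hy hz /andP[k0 le_kT] yz.
have cy := is_cvg_expansion hy; have cz := is_cvg_expansion hz.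
set x := lim _; set x' := lim _; set c := _ / _.
have cv : `|\sum_(1 <= i < n) ((y i)%:R / q%:R ^+ i : R)
    - \sum_(1 <= i < n) ((z i)%:R / q%:R ^+ i : R) - c| @[n --> \oo] --> `|x - x' - c|.
  by apply: cvg_norm; apply: cvgB; [exact: cvgB|exact: cvg_cst].
rewrite -(cvg_lim (@Rhausdorff R) cv); apply: limr_le.
  by apply/cvg_ex; exists `|x - x' - c|.
near=> n; have lt_Tn : (T < n)%N by near: n; exact: nbhs_infty_gt.
rewrite -sumrB (big_cat_nat (n := T.+1)) //=.
have -> : \sum_(1 <= i < T.+1) ((y i)%:R / q%:R ^+ i - (z i)%:R / q%:R ^+ i) = c.
  transitivity (\sum_(1 <= i < T.+1 | i == k) c); last first.
    by rewrite big_nat1_eq ltnS k0 le_kT.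
  rewrite [RHS]big_mkcond /=; apply: eq_big_nat => i; rewrite ltnS => hi.
  case: eqP => [->|/eqP neq_ik]; first by rewrite -mulrBl.
  by rewrite yz // subrr.
rewrite addrAC subrr add0r; apply: le_trans (ler_norm_sum _ _ _) _.
under eq_bigr => i _ do rewrite -mulrBl.
apply: sum_digits_le => i; have := hy i; have := hz i.
rewrite -[q]prednK ?(ltnW q_gt1) // !ltnS -!(ler_nat R) ler_norml.
have : 0 <= (y i)%:R :> R by []. have : 0 <= (z i)%:R :> R by [].
lra.
Unshelve. all: by end_near.
Qed.

End Expansions.

(** * Distance to the nearest integer *)

Section Distance.
Local Open Scope classical_set_scope.
Variable R : realType.
Implicit Type y : R.

(** A nonzero integer has absolute value at least 1, so its distance from y is at least 1/2. *)
Lemma dist_int_small y : `|y| <= 2^-1 -> dist_int y = `|y|.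
Proof.
move=> hy; apply/eqP; rewrite eq_le; apply/andP; split.
  apply: ge_inf; last by exists 0 => //=; rewrite subr0.
  by exists 0 => _ [m _ <-].
apply: lb_le_inf; first by exists `|y - 0%:~R|; exists 0.
move=> _ [m _ <-]; have [->|m0] := eqVneq m 0; first by rewrite subr0.
have hm : 1 <= `|m%:~R : R|.
  by rewrite -intr_norm ler1z; lia.
have := ler_distD y 0 (m%:~R : R); rewrite !sub0r !normrN distrC.
lra.
Qed.

Lemma dist_int_ge0 y : 0 <= dist_int y.
Proof.
apply: lb_le_inf; first by exists `|y - 0%:~R|; exists 0.
by move=> _ [m _ <-].
Qed.

Lemma dist_int_max_attained d (v : 'rV[R]_d) : (0 < d)%N ->
  exists j, dist_int_max v = dist_int (v 0 j).
Proof.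
case: d v => // d v _; rewrite /dist_int_max.
rewrite (@bigmax_eq_arg _ _ _ _ ord0) // => [|j _]; last exact: dist_int_ge0.
by eexists.
Qed.

End Distance.

(** * Concentrated distances contradict Poissonian pair correlations *)

Section Atoms.
Local Open Scope classical_set_scope.
Variable R : realType.

Lemma cvg_sum_fin (T : Type) (U : set_system T) {FU : Filter U} (I : Type) (r : seq I)
    (f : I -> T -> R) (a : I -> R) :
  (forall i, f i t @[t --> U] --> a i) ->
  \sum_(i <- r) f i t @[t --> U] --> \sum_(i <- r) a i.
Proof.
move=> fa; elim: r => [|i r IH].
  by rewrite big_nil; under eq_fun do rewrite big_nil; exact: cvg_cst.
by rewrite big_cons; under eq_fun do rewrite big_cons; exact: cvgD.
Qed.

Lemma cvg_expr (T : Type) (U : set_system T) {FU : Filter U} (f : T -> R) (a : R) d :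
  f t @[t --> U] --> a -> f t ^+ d @[t --> U] --> a ^+ d.
Proof. by move=> fa; exact: (cvg_comp _ _ fa (@exprn_continuous R d a)). Qed.

(* Along a subsequence of N, the rescaled distances of at least N pairs stay
   close to finitely many values s i, so the limiting pair correlation
   function would have to jump at one of them. *)
Lemma concentrated_not_poissonian d (x : nat -> 'rV[R]_d) (K : nat) (s : 'I_K -> R) :
  (forall i, 0 < s i) ->
  (forall e N0, 0 < e -> exists N : nat, (N0 <= N)%N /\ (0 < N)%N /\
     exists l : 'I_N -> 'I_N, forall n, l n != n /\ exists i,
       (s i - e) * N%:R `^ (- d%:R^-1) < dist_int_max (x n - x (l n))
         <= (s i + e) * N%:R `^ (- d%:R^-1)) ->
  ~ poissonian_pair_correlations x.
Proof.
move=> s0 conc ppc.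
(* The limiting mass of the windows of half-width e around the s_i. It tends to 0 with e, whereas
   the given pairs force mass at least 1. *)
pose h e := \sum_i ((2 * (s i + e)) ^+ d - (2 * (s i - e)) ^+ d).
(* The bound [e <= s i] keeps s_i - e nonnegative, as required to apply [ppc] to it. *)
have [e [e0 le_es lt_h]] : exists e, [/\ 0 < e, forall i, e <= s i & h e < 1].
  suff: \forall e \near 0^'+, 0 < e /\ ((forall i, e <= s i) /\ h e < 1).
    by move=> /filter_ex[e [? [? ?]]]; exists e.
  apply: filterI; first exact: nbhs_right_gt.
  apply: filterI.
    exact: (@filter_forall R _ (fun i e => is_true (e <= s i)) 0^'+ _
      (fun i => nbhs_right_le (s0 i))).
  have ch : h e @[e --> 0^'+] --> \sum_(i < K) (0 : R).
    apply: cvg_at_right_filter; apply: cvg_sum_fin => i.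
    rewrite -[X in _ --> X](subrr ((2 * s i) ^+ d)); apply: cvgB.
      apply: cvg_expr; apply: cvgM; first exact: cvg_cst.
      by rewrite -[X in _ --> X]addr0; apply: cvgD; [exact: cvg_cst|exact: cvg_id].
    apply: cvg_expr; apply: cvgM; first exact: cvg_cst.
    by rewrite -[X in _ --> X]subr0; apply: cvgB; [exact: cvg_cst|exact: cvg_id].
  by apply: (cvgr_lt _ ch); rewrite big1.
pose cp r N := close_pairs x N (r * N%:R `^ (- d%:R^-1)).
have : \sum_i ((cp (s i + e) N)%:R / N%:R - (cp (s i - e) N)%:R / N%:R)
    @[N --> \oo] --> h e.
  apply: cvg_sum_fin => i; apply: cvgB; apply: ppc.
    by rewrite addr_ge0 // ltW.
  by rewrite subr_ge0.
move=> /cvgr_lt/(_ _ lt_h)[N0 _ hN0].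
have [N [/hN0/= ltN1 [N1 [l hl]]]] := conc e N0 e0.
move: ltN1; apply/negP; rewrite -leNgt.
under eq_bigr => i _ do rewrite -mulrBl.
rewrite -mulr_suml ler_pdivlMr ?ltr0n // mul1r.
have /choice[f hf] n := (hl n).2.
pose A r : {set 'I_N * 'I_N} := [set p : 'I_N * 'I_N |
  (p.1 != p.2) && (dist_int_max (x p.1 - x p.2) <= r * N%:R `^ (- d%:R^-1))]%SET.
(* The n < N are sorted by the window of their pair. Each class injects into the pairs counted
   there, n being the first component of (n, l n). *)
have defN : N = (\sum_i #|[set n | f n == i]%SET|)%N.
  rewrite -[LHS]card_ord -sum1_card (partition_big f xpredT) //=.
  by apply: eq_bigr => i _; rewrite -sum1_card; apply: eq_bigl => n; rewrite !inE.
rewrite [X in X%:R <= _]defN natr_sum; apply: ler_sum => i _.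
have sAA : (A (s i - e) \subset A (s i + e))%SET.
  apply/fintype.subsetP => p; rewrite !inE => /andP[-> /le_trans]; apply.
  by rewrite ler_wpM2r ?powR_ge0 //; lra.
rewrite lerBrDr -natrD ler_nat /cp /close_pairs -/(A _) -/(A _).
rewrite -[leqRHS](subnK (subset_leq_card sAA)) leq_add2r -cardsDS //.
have inj_l : injective (fun n => (n, l n)) by move=> n n' /(congr1 fst).
rewrite -(card_imset _ inj_l).
apply/subset_leq_card/fintype.subsetP => _ /imsetP[n + ->]; rewrite inE => /eqP fn.
rewrite !inE /= eq_sym (hl n).1 /=.
by have := hf n; rewrite fn ltNge.
Qed.

End Atoms.

(** * The paired terms and the final contradiction *)

Lemma row_form_near_power (F : fieldType) (g u : {poly F}) C s t i :
  adic_rows g C -> (1 < size g)%N ->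
  (0 < i <= (size g).-1 * s + t)%N ->
  row_form C i (g ^+ s + u * g ^+ (s + t)) = (i == ((size g).-1 * s).+1)%:R.
Proof.
move=> [row0 row1] g1 /andP[i0 le_i]; rewrite row_formD row1 // row0 ?addr0 // i0.
(* As e >= 1, i <= e s + t <= e (s + t), so the multiple of g^(s+t) contributes nothing. *)
by rewrite (leq_trans le_i) // mulnDr leq_add2l leq_pmull // -ltnS prednK // ltnW.
Qed.

Lemma natr_dist (R : numDomainType) (q a b : nat) : (a < q)%N -> (b < q)%N -> a != b ->
  exists2 D : nat, (0 < D < q)%N & D%:R = `|a%:R - b%:R| :> R.
Proof.
wlog lt_ab : a b / (b < a)%N => [wlog_ab lt_aq lt_bq neq_ab|lt_aq _ _].
  case: (ltngtP a b) => [lt_ab|lt_ba|eq_ab]; last by rewrite eq_ab eqxx in neq_ab.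
    by rewrite distrC; apply: wlog_ab; rewrite // eq_sym.
  exact: wlog_ab.
exists (a - b)%N; first by rewrite subn_gt0 lt_ab (leq_ltn_trans (leq_subr _ _)).
by rewrite natrB ?(ltnW lt_ab) // ger0_norm // subr_ge0 ler_nat ltnW.
Qed.

(** The digits at m + 1 differ because [phi] is injective and 1 != 0, so D > 0. As m > 0, the
    coordinates differ by at most q / q^(m+1) <= 1/2, where [dist_int] is the absolute value. *)
Lemma digital_coord_dist (R : realType) (F : finFieldType) (phi : F -> 'I_#|F|)
    (C : nat -> nat -> F) (n l m t : nat) :
  injective phi -> (0 < m)%N -> (0 < t)%N ->
  (forall i, (0 < i <= m + t)%N ->
     digital_entry phi C l i = digital_entry phi C n i - (i == m.+1)%:R) ->
  exists2 D : nat, (0 < D < #|F|)%N &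
    `|dist_int (digital_coord R phi C n - digital_coord R phi C l)
      - D%:R / #|F|%:R ^+ m.+1| <= #|F|%:R ^- (m + t).
Proof.
move=> phi_inj m0 t0 hl; have q1 := card_finNzRing_gt1 F.
pose y i : nat := phi (digital_entry phi C n i).
pose z i : nat := phi (digital_entry phi C l i).
have lt_mt : (0 < m.+1 <= m + t)%N by lia.
have yz i : (0 < i <= m + t)%N -> i != m.+1 -> y i = z i.
  by move=> hi /negPf neq_i; rewrite /y /z hl // neq_i subr0.
have neq_yz : y m.+1 != z m.+1.
  rewrite /y /z hl // eqxx; apply/eqP => /val_inj/phi_inj/eqP.
  by rewrite -subr_eq0 opprB addrCA subrr addr0 oner_eq0.
have hy i : (y i < #|F|)%N by exact: ltn_ord.
have hz i : (z i < #|F|)%N by exact: ltn_ord.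
have := expansion_diff R q1 hy hz lt_mt yz.
rewrite -/(digital_coord R phi C n) -/(digital_coord R phi C l).
set v := _ - digital_coord R phi C l => hv.
have [D hD absD] : exists2 D : nat, (0 < D < #|F|)%N &
    D%:R = `|(y m.+1)%:R - (z m.+1)%:R| :> R.
  exact: natr_dist.
exists D => //.
have q0 : 0 < #|F|%:R :> R by rewrite ltr0n ltnW.
have hvD : `| `|v| - D%:R / #|F|%:R ^+ m.+1| <= #|F|%:R ^- (m + t).
  apply: le_trans hv; rewrite absD
    -[X in _ / X](@gtr0_norm _ (#|F|%:R ^+ m.+1)) ?exprn_gt0 //.
  by rewrite -normf_div ler_dist_dist.
suff small : `|v| <= 2^-1 by rewrite dist_int_small.
have h1 : #|F|%:R ^- (m + t) <= #|F|%:R ^- m.+1 :> R.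
  rewrite lef_pV2 ?posrE ?exprn_gt0 //; apply: ler_weXn2l; last by case/andP: lt_mt.
  by rewrite ler1n ltnW.
have h2 : D%:R + 1 <= #|F|%:R :> R by rewrite natr1 ler_nat; case/andP: hD.
have h3 : #|F|%:R / #|F|%:R ^+ m.+1 <= 2^-1 :> R.
  rewrite exprS invfM mulrA mulfV ?mul1r ?gt_eqF // lef_pV2 ?posrE ?exprn_gt0 //.
  rewrite -natrX ler_nat (leq_trans q1) // -{1}[#|F|]expn1 leq_exp2l //.
have qm0 : 0 < #|F|%:R ^- m.+1 :> R by rewrite invr_gt0 exprn_gt0.
have h4 := ler_wpM2r (ltW qm0) h2; rewrite mulrDl mul1r in h4.
move: hvD; rewrite ler_norml => /andP[_]; lra.
Qed.

Theorem theorem1 (R : realType) (d : nat) (d_gt0 : (0 < d)%N)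
    (F : finFieldType) (phi : F -> 'I_#|F|) (phi_bij : bijective phi)
    (phi0 : (phi 0 : nat) = 0%N)
    (g : 'I_d -> {poly F})
    (g_monic : forall j : 'I_d, g j \is monic)
    (g_nonconst : forall j : 'I_d, (1 < size (g j))%N)
    (g_coprime : forall i j : 'I_d, i != j -> coprimep (g i) (g j))
    (C : 'I_d -> nat -> nat -> F)
    (hC : (forall j : 'I_d, niederreiter_matrix (g j) (C j)) \/
          (forall j : 'I_d, column_matrix (g j) (C j))) :
  ~ poissonian_pair_correlations (digital_seq R phi C).
Proof.
have rowsC j : adic_rows (g j) (C j).
  by case: hC => hC; [apply: niederreiter_adic_rows|apply: column_adic_rows].
have [A [p [A0 p1 hQ]]] := common_near_power g_monic g_nonconst g_coprime.
have q1 := card_finNzRing_gt1 F.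
have q0 : 0 < #|F|%:R :> R by rewrite ltr0n ltnW.
pose theta : R := #|F|%:R `^ (- d%:R^-1).
have theta0 : 0 < theta by rewrite powR_gt0.
(* For N = q^(d m + 1) a distance D q^-(m+1) thus rescales to D / (q theta), free of m. These
   values, with D = i + 1, are the atoms chosen below. *)
have scale m : (#|F| ^ (d * m).+1)%:R `^ (- d%:R^-1) = theta / #|F|%:R ^+ m.
  have qm0 : 0 < #|F|%:R ^+ m :> R by rewrite exprn_gt0.
  rewrite natrX exprSr mulnC exprM powRM ?exprn_ge0 ?(ltW q0) //.
  rewrite -powR_mulrn ?exprn_ge0 ?(ltW q0) // -powRrM mulrN mulfV ?pnatr_eq0 -?lt0n //.
  by rewrite powR_inv1 ?(ltW qm0) // mulrC.
apply: (@concentrated_not_poissonian R d _ #|F|.-1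
  (fun i => (i.+1)%:R / (#|F|%:R * theta))) => // [i|e N0 e0].
  by rewrite divr_gt0 // mulr_gt0.
have et0 : 0 < e * theta by rewrite mulr_gt0.
(* The first summand ensures N >= N0, the Archimedean bound that q^(p^w) exceeds 1 / (e theta). *)
pose w := (N0 + Num.bound (e * theta)^-1)%N.
have lt_w : (w < p ^ w)%N by exact: ltn_expl.
have [Q [szQ hQj]] := hQ w; set m := (A * p ^ w)%N in szQ hQj.
have t0 : (0 < p ^ w)%N by exact: leq_ltn_trans lt_w.
have m0 : (0 < m)%N by rewrite muln_gt0 A0.
set N := (#|F| ^ (d * m).+1)%N.
exists N; split; [|split; first by rewrite expn_gt0 ltnW].
  have le_N0 : (N0 <= w)%N by exact: leq_addr.
  apply: (leq_trans le_N0); apply: (leq_trans (ltnW lt_w)).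
  apply: (@leq_trans m); first exact: leq_pmull.
  apply: (@leq_trans (d * m).+1); first by rewrite leqW // leq_pmull.
  exact/ltnW/ltn_expl.
(* Since deg Q = d m, subtracting Q preserves the polynomials of degree at most d m, which are those
   of the n < N. *)
have /choice[l hl] (n : 'I_N) :
    exists l : 'I_N, digits_poly phi l = digits_poly phi n - Q.
  have [|l lt_l hl] := @digits_poly_onto _ _ phi_bij phi0 (d * m).+1
    (digits_poly phi n - Q).
    rewrite (leq_trans (size_polyD _ _)) // size_polyN geq_max szQ leqnn andbT.
    by rewrite (size_digits_poly phi_bij phi0) // ltn_ord.
  by exists (Ordinal lt_l).
exists l => n; split.
  apply/eqP => eq_ln; move: (hl n); rewrite eq_ln => /eqP.
  by rewrite -subr_eq0 opprB addrCA subrr addr0 -size_poly_eq0 szQ.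
(* Every coordinate obeys the same estimate with its own D, so one that attains the maximum
   suffices. *)
have [j ->] := dist_int_max_attained
  (digital_seq R phi C n - digital_seq R phi C (l n)) d_gt0.
rewrite !mxE.
have [|D /andP[D0 lt_D] hD] := @digital_coord_dist R F phi (C j) n (l n) m (p ^ w)
    (bij_inj phi_bij) m0 t0.
  have [s [u [def_m def_Q]]] := hQj j.
  move=> i hi; rewrite !(digital_entryE phi) hl row_formD row_formN def_Q.
  by rewrite row_form_near_power ?def_m.
have lt_D' : (D.-1 < #|F|.-1)%N by rewrite -ltnS !prednK // ltnW.
exists (Ordinal lt_D'); rewrite /= prednK // scale.
have qm0 : 0 < #|F|%:R ^- m :> R by rewrite invr_gt0 exprn_gt0.
(* The error is below the half-width e N^(-1/d) = e theta q^-m of the window. *)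
have lt_e : #|F|%:R ^- (m + p ^ w) < e * theta * #|F|%:R ^- m.
  rewrite exprD invfM mulrC ltr_pM2r // -[X in _ < X]invrK
    ltf_pV2 ?posrE ?invr_gt0 ?exprn_gt0 //.
  have /archi_boundP lt_b : 0 <= (e * theta)^-1 by rewrite invr_ge0 ltW.
  apply: (lt_le_trans lt_b); rewrite -natrX ler_nat.
  apply: (@leq_trans w); first exact: leq_addl.
  by rewrite (leq_trans (ltnW lt_w)) // ltnW // ltn_expl.
have sE : D%:R / (#|F|%:R * theta) * (theta / #|F|%:R ^+ m) = D%:R / #|F|%:R ^+ m.+1.
  by rewrite exprS !invfM -!mulrA; congr (_ * (_ * _)); rewrite mulKf ?gt_eqF.
rewrite mulrBl mulrDl sE mulrA.
by have := le_lt_trans hD lt_e; rewrite ltr_distl => /andP[-> /ltW].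
Qed.
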